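(* Let $(L,\tau)$ be a compact topological residuated lattice. Then the following are equivalent: (i) $(L,\tau)$ is profinite; (ii) there is a set $\mathcal{S}$ of clopen filters of $L$ such that (a) the poset $(\mathcal{S},\supseteq)$ is directed (i.e., for all $F,G\in\mathcal{S}$ there is $H\in\mathcal{S}$ with $H\subseteq F\cap G$), and (b) for all $x,y\in L$ with $x\ne y$ there is a filter $F\in\mathcal{S}$ such that $x/F\ne y/F$.
   Context: A residuated lattice is an algebra $(L,\wedge,\vee,\odot,\rightarrow,0,1)$ such that $(L,\wedge,\vee,0,1)$ is a bounded lattice, $(L,\odot,1)$ is a commutative monoid, and $x\odot y\le z$ iff $x\le y\rightarrow z$. A topological residuated lattice is a residuated lattice with a topology making $\wedge,\vee,\odot,\rightarrow$ continuous. A filter of $L$ is a nonempty $F\subseteq L$ such that $x,y\in F$ implies $x\odot y\in F$, and $x\in F$, $x\le y$ imply $y\in F$. For a filter $F$, $\theta_F=\{(x,y):(x\rightarrow y)\odot(y\rightarrow x)\in F\}$ is a congruence, $x/F$ denotes the $\theta_F$-class of $x$ and $L/F$ the quotient residuated lattice. A clopen filter is a filter that is both open and closed. $(L,\tau)$ is profinite if it is isomorphic, as a topological residuated lattice, to the inverse limit $\{(a_i)\in\prod_{i\in I}L_i:\varphi_{ij}(a_i)=a_j\ \forall j\le i\}$ of an inverse system $\{L_i,\varphi_{ij},I\}$ (directed poset $I$, homomorphisms $\varphi_{ij}:L_i\to L_j$ for $j\le i$, $\varphi_{ii}=\mathrm{id}$, $\varphi_{ik}=\varphi_{jk}\varphi_{ij}$)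 of finite residuated lattices, carrying the subspace topology of the product of the discrete spaces $L_i$. *)

(* Defs.v *)
From HB Require Import structures.
From mathcomp Require Import all_boot all_order all_algebra.
From mathcomp Require Import all_classical all_reals all_analysis.

Set Implicit Arguments.
Unset Strict Implicit.
Unset Printing Implicit Defensive.
Import Order.TTheory.
Local Open Scope classical_set_scope.
Local Open Scope order_scope.

Declare Scope reslat_scope.
Delimit Scope reslat_scope with RL.
Reserved Notation "x \odot y" (at level 40, left associativity).
Reserved Notation "x \imp y" (at level 45, right associativity).

#[key="T"]
HB.mixin Record TBLattice_isResiduated d T of Order.TBLattice d T := {
  odot : T -> T -> T;
  imp : T -> T -> T;
  odotA : associative odot;
  odotC : commutative odot;
  odot1x : left_id \top odot;
  odot_imp : forall x y z : T, (odot x y <= z) = (x <= imp y z);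
}.

#[short(type="resLatticeType")]
HB.structure Definition ResLattice d :=
  { T of TBLattice_isResiduated d T & Order.TBLattice d T }.

Notation "x \odot y" := (odot x y) : reslat_scope.
Notation "x \imp y" := (imp x y) : reslat_scope.
Local Open Scope reslat_scope.

(* The library joins Nbhs with MeetSemilattice only through total orders
   (OrderNbhs), so lattices and topologies have no other common HB substructure;
   the topology is therefore a separate component of the pair (L, tau). *)
Definition space (T : Type) (tau : Topological T) : topologicalType :=
  Topological.Pack tau.

Definition continuous_op (T : Type) (tau : Topological T) (op : T -> T -> T) :=
  continuous ((fun z => op z.1 z.2) : space tau * space tau -> space tau).

Record topResLatticeType d := TopResLattice {
  topreslat_lattice :> resLatticeType d;
  reslat_topology : Topological topreslat_lattice;
  meet_continuous : continuous_op reslat_topology Order.meet;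
  join_continuous : continuous_op reslat_topology Order.join;
  odot_continuous : continuous_op reslat_topology odot;
  imp_continuous : continuous_op reslat_topology imp;
}.

Definition topspace d (L : topResLatticeType d) : topologicalType :=
  space (reslat_topology L).

Record reslat_morphism d (L : resLatticeType d) d' (M : resLatticeType d')
    (f : L -> M) : Prop := {
  reslat_morphI : {morph f : x y / x `&` y};
  reslat_morphU : {morph f : x y / x `|` y};
  reslat_morphM : {morph f : x y / x \odot y};
  reslat_morphR : {morph f : x y / x \imp y};
  reslat_morph0 : f \bot = \bot;
  reslat_morph1 : f \top = \top;
}.

Definition top_reslat_isomorphic d (L : topResLatticeType d)
    d' (M : topResLatticeType d') : Prop :=
  exists (f : L -> M) (g : M -> L),
    [/\ reslat_morphism f, cancel f g, cancel g f,
        continuous (f : topspace L -> topspace M)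
      & continuous (g : topspace M -> topspace L)].

(* Filters in the algebraic sense (not set filters). *)
Record reslat_filter d (L : resLatticeType d) (F : set L) : Prop := {
  reslat_filter_nonempty : F !=set0;
  reslat_filterM : forall x y, F x -> F y -> F (x \odot y);
  reslat_filterW : forall x y, F x -> x <= y -> F y;
}.

Definition theta d (L : resLatticeType d) (F : set L) (x y : L) : Prop :=
  F ((x \imp y) \odot (y \imp x)).

Definition theta_class d (L : resLatticeType d) (F : set L) (x : L) : set L :=
  [set y | theta F x y].

(* The bonding map phi i j goes from L_i to L_j for j <= i. *)
Record inverse_system := InverseSystem {
  idx_disp : Order.disp_t;
  idx : porderType idx_disp;
  idx_directed : forall i j : idx, exists k, i <= k /\ j <= k;
  obj_disp : Order.disp_t;
  obj : idx -> resLatticeType obj_disp;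
  bond : forall i j : idx, j <= i -> obj i -> obj j;
  bond_morphism : forall i j (ji : j <= i), reslat_morphism (bond ji);
  bond_id : forall i, bond (lexx i) =1 id;
  bond_comp : forall i j k (ji : j <= i) (kj : k <= j),
    bond (le_trans kj ji) =1 bond kj \o bond ji;
}.

Section inverse_limit.
Variable S : inverse_system.

Let prod_obj := prod_topology (fun i : idx S => discrete_topology (obj i)).

Definition threads : set prod_obj :=
  [set a | forall i j (ji : j <= i), bond ji (a i) = a j].

Definition lim_type : Type := set_type threads.

HB.instance Definition _ := Topological.on lim_type.

Definition lim_coord (i : idx S) (a : lim_type) : obj i := set_val a i.

Lemma lim_coord_bond i j (ji : j <= i) a : bond ji (lim_coord i a) = lim_coord j a.
Proof. exact: (set_valP a). Qed.

Lemma lim_coord_inj a b : (forall i, lim_coord i a = lim_coord i b) -> a = b.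
Proof.
by move=> ab; apply: val_inj; apply: functional_extensionality_dep => i; exact: ab.
Qed.

Definition mk_thread (a : forall i : idx S, obj i)
    (aP : forall i j (ji : j <= i), bond ji (a i) = a j) : lim_type :=
  SigSub (mem_set (aP : threads a)).

Definition lim_le : rel lim_type :=
  fun a b => `[< forall i, lim_coord i a <= lim_coord i b >].

Lemma lim_le_refl : reflexive lim_le.
Proof. by move=> a; apply/asboolP. Qed.

Lemma lim_le_anti : antisymmetric lim_le.
Proof.
move=> a b /andP[/asboolP ab /asboolP ba]; apply: lim_coord_inj => i.
by apply: le_anti; rewrite ab ba.
Qed.

Lemma lim_le_trans : transitive lim_le.
Proof.
move=> b a c /asboolP ab /asboolP bc; apply/asboolP => i.
exact: le_trans (ab i) (bc i).
Qed.

HB.instance Definition _ := @Order.Le_isPOrder.Build (obj_disp S) lim_type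
  lim_le lim_le_refl lim_le_anti lim_le_trans.

Lemma lim_leP (a b : lim_type) :
  reflect (forall i, lim_coord i a <= lim_coord i b) (a <= b).
Proof. exact: asboolP. Qed.

Definition lim_meet (a b : lim_type) : lim_type.
Proof.
apply: (@mk_thread (fun i => lim_coord i a `&` lim_coord i b)) => i j ji.
by rewrite (reslat_morphI (bond_morphism ji)) !lim_coord_bond.
Defined.

Definition lim_join (a b : lim_type) : lim_type.
Proof.
apply: (@mk_thread (fun i => lim_coord i a `|` lim_coord i b)) => i j ji.
by rewrite (reslat_morphU (bond_morphism ji)) !lim_coord_bond.
Defined.

Definition lim_odot (a b : lim_type) : lim_type.
Proof.
apply: (@mk_thread (fun i => lim_coord i a \odot lim_coord i b)) => i j ji.
by rewrite (reslat_morphM (bond_morphism ji)) !lim_coord_bond.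
Defined.

Definition lim_imp (a b : lim_type) : lim_type.
Proof.
apply: (@mk_thread (fun i => lim_coord i a \imp lim_coord i b)) => i j ji.
by rewrite (reslat_morphR (bond_morphism ji)) !lim_coord_bond.
Defined.

Definition lim_bot : lim_type.
Proof.
apply: (@mk_thread (fun=> \bot)) => i j ji.
exact: reslat_morph0 (bond_morphism ji).
Defined.

Definition lim_top : lim_type.
Proof.
apply: (@mk_thread (fun=> \top)) => i j ji.
exact: reslat_morph1 (bond_morphism ji).
Defined.

Lemma lim_meetP a b c : (a <= lim_meet b c) = (a <= b) && (a <= c).
Proof.
apply/lim_leP/andP => [abc|[/lim_leP ab /lim_leP ac] i]; last first.
  by rewrite lexI ab ac.
by split; apply/lim_leP => i; have := abc i; rewrite lexI => /andP[].
Qed.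

Lemma lim_joinP a b c : (lim_join a b <= c) = (a <= c) && (b <= c).
Proof.
apply/lim_leP/andP => [abc|[/lim_leP ac /lim_leP bc] i]; last first.
  by rewrite leUx ac bc.
by split; apply/lim_leP => i; have := abc i; rewrite leUx => /andP[].
Qed.

HB.instance Definition _ :=
  @Order.POrder_MeetJoin_isLattice.Build (obj_disp S) lim_type
    lim_meet lim_join lim_meetP lim_joinP.

Lemma lim_le0x (a : lim_type) : lim_bot <= a.
Proof. by apply/lim_leP => i; exact: le0x. Qed.

Lemma lim_lex1 (a : lim_type) : a <= lim_top.
Proof. by apply/lim_leP => i; exact: lex1. Qed.

HB.instance Definition _ :=
  @Order.hasBottom.Build (obj_disp S) lim_type lim_bot lim_le0x.
HB.instance Definition _ :=
  @Order.hasTop.Build (obj_disp S) lim_type lim_top lim_lex1.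

Lemma lim_odotA : associative lim_odot.
Proof. by move=> a b c; apply: lim_coord_inj => i; exact: odotA. Qed.

Lemma lim_odotC : commutative lim_odot.
Proof. by move=> a b; apply: lim_coord_inj => i; exact: odotC. Qed.

Lemma lim_odot1x : left_id \top lim_odot.
Proof. by move=> a; apply: lim_coord_inj => i; exact: odot1x. Qed.

Lemma lim_odot_imp (a b c : lim_type) :
  (lim_odot a b <= c) = (a <= lim_imp b c).
Proof.
by apply/lim_leP/lim_leP => abc i; have := abc i; rewrite odot_imp.
Qed.

HB.instance Definition _ :=
  @TBLattice_isResiduated.Build (obj_disp S) lim_type
    lim_odot lim_imp lim_odotA lim_odotC lim_odot1x lim_odot_imp.

Lemma lim_coord_continuous i :
  continuous (lim_coord i : lim_type -> discrete_topology (obj i)).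
Proof.
pose K (j : idx S) : topologicalType := discrete_topology (obj j).
move=> a; apply: (@continuous_comp lim_type (prod_topology K) (K i)
  set_val (fun b => b i)).
  exact: (@initial_continuous _ _ (set_val : lim_type -> prod_obj)).
exact: (@proj_continuous _ K i).
Qed.

Lemma lim_continuous (X : topologicalType) (f : X -> lim_type) :
  (forall i, continuous (lim_coord i \o f : X -> discrete_topology (obj i))) ->
  continuous f.
Proof.
move=> cf; apply: continuous_comp_initial => x; apply/cvg_sup => i.
exact: (@continuous_comp_initial _ _ _
  (fun a : prod_obj => a i) (set_val \o f) (cf i)).
Qed.

Lemma lim_op_continuous (op : forall i : idx S, obj i -> obj i -> obj i)
    (f : lim_type * lim_type -> lim_type) :
  (forall i z, lim_coord i (f z) = op i (lim_coord i z.1) (lim_coord i z.2)) ->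
  continuous f.
Proof.
move=> fE; apply: lim_continuous => i z.
apply/discrete_cvg => /=.
exists ((lim_coord i) @^-1` [set lim_coord i z.1], (lim_coord i) @^-1` [set lim_coord i z.2]).
  by split; apply: (@lim_coord_continuous i); exact: discrete_set1.
by move=> [a b] [/= az bz]; rewrite /= !fE /= az bz.
Qed.

Definition inverse_limit : topResLatticeType (obj_disp S) :=
  @TopResLattice (obj_disp S) lim_type (Topological.class lim_type)
    (@lim_op_continuous (fun=> Order.meet)
      (fun z => lim_meet z.1 z.2) (fun _ _ => erefl))
    (@lim_op_continuous (fun=> Order.join)
      (fun z => lim_join z.1 z.2) (fun _ _ => erefl))
    (@lim_op_continuous (fun=> odot)
      (fun z => lim_odot z.1 z.2) (fun _ _ => erefl))
    (@lim_op_continuous (fun=> imp)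
      (fun z => lim_imp z.1 z.2) (fun _ _ => erefl)).

End inverse_limit.

Definition profinite d (L : topResLatticeType d) : Prop :=
  exists S : inverse_system,
    (forall i : idx S, finite_set [set: obj i]) /\
    top_reslat_isomorphic L (inverse_limit S).

(* Main.v *)
Require Import Defs.
From HB Require Import structures.
From mathcomp Require Import all_boot all_order all_algebra.
From mathcomp Require Import all_classical all_reals all_analysis.
From mathcomp Require Import generic_quotient.

(* If L is the limit of finite L_i, the kernels of the projections L -> L_i
   (preimages of the top element) form the required family of clopen filters.

   Conversely, given S, each quotient L/F with F in S is finite because
   x |-> x/F is continuous into a discrete space, and L maps to the limit of the
   L/F, injectively by (b).  Given a thread a, the fibers of the projections
   over the a_F form a directed family of nonempty closed sets, so compactness
   gives a point of L mapping to a; applied inside the complement of an open V,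
   the same argument shows that if the preimage of a lies in V then so does an
   entire fiber over some a_F, which is continuity of the inverse. *)

Set Implicit Arguments.
Unset Strict Implicit.
Unset Printing Implicit Defensive.
Import Order.TTheory.
Local Open Scope classical_set_scope.
Local Open Scope order_scope.
Local Open Scope quotient_scope.
Local Open Scope reslat_scope.

(** * Arithmetic of residuation *)

Section residuation.
Context {d : Order.disp_t} {L : resLatticeType d}.
Implicit Types x y z u v : L.

Lemma odotx1 : right_id \top (@odot d L).
Proof. by move=> x; rewrite odotC odot1x. Qed.

Lemma imp_le x y : (x \imp y = \top) <-> x <= y.
Proof.
split=> xy; first by rewrite -[x]odot1x odot_imp xy.
by apply/eqP; rewrite -le1x -odot_imp odot1x.
Qed.

Lemma odot_impl x y : (x \imp y) \odot x <= y.
Proof. by rewrite odot_imp. Qed.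

Lemma odot_le2r z x y : x <= y -> x \odot z <= y \odot z.
Proof. by move=> xy; rewrite odot_imp (le_trans xy)// -odot_imp. Qed.

Lemma odot_le2l z x y : x <= y -> z \odot x <= z \odot y.
Proof. by move=> xy; rewrite ![z \odot _]odotC odot_le2r. Qed.

Lemma odot_lel x y : x \odot y <= x.
Proof. by rewrite -{2}[x]odotx1 odot_le2l// lex1. Qed.

Lemma odot_ler x y : x \odot y <= y.
Proof. by rewrite odotC odot_lel. Qed.

Lemma odot_eq1 x y : x \odot y = \top <-> x = \top /\ y = \top.
Proof.
split=> [xy|[-> ->]]; last by rewrite odot1x.
by split; apply/eqP; rewrite -le1x -xy ?odot_lel ?odot_ler.
Qed.

Lemma biimp_eq1 x y : (x \imp y) \odot (y \imp x) = \top <-> x = y.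
Proof.
rewrite odot_eq1 !imp_le; split=> [[xy yx]|->]; last by [].
by apply/le_anti; rewrite xy yx.
Qed.

(** By adjunction and associativity both sides have the same lower bounds. Under a filter, this
    identity becomes the adjunction of the quotient. *)
Lemma imp_odot x y z : (x \odot y) \imp z = x \imp (y \imp z).
Proof.
have E u : (u <= (x \odot y) \imp z) = (u <= x \imp (y \imp z)).
  by rewrite -!odot_imp odotA.
by apply/le_anti; rewrite -E lexx E lexx.
Qed.

End residuation.

(** * The preorder [F (x \imp y)] of a filter and its congruence *)

Section filter_preorder.
Context {d : Order.disp_t} {L : resLatticeType d} {F : set L}.
Hypothesis FF : reslat_filter F.
Implicit Types x y z : L.

Lemma reslat_filter1 : F \top.
Proof.
have [x Fx] := reslat_filter_nonempty FF.
exact: (reslat_filterW FF Fx (lex1 x)).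
Qed.

Lemma reslat_filterE x y : F (x \odot y) <-> F x /\ F y.
Proof.
split=> [Fxy|[]]; last exact: reslat_filterM.
by split; apply: (reslat_filterW FF Fxy); rewrite ?odot_lel ?odot_ler.
Qed.

Lemma filter_imp_le x y : x <= y -> F (x \imp y).
Proof. by move=> /imp_le ->; exact: reslat_filter1. Qed.

(** Applying modus ponens twice gives [(y \imp z) \odot (x \imp y) <= x \imp z]. With
    [filter_imp_le] this yields a preorder, which will be the order of the quotient. *)
Lemma filter_imp_trans y x z : F (x \imp y) -> F (y \imp z) -> F (x \imp z).
Proof.
move=> Fxy Fyz; apply: (reslat_filterW FF (reslat_filterM FF Fyz Fxy)).
rewrite -odot_imp -odotA; apply: le_trans (odot_impl y z).
exact: odot_le2l (odot_impl x y).
Qed.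

(** Meets of [L] are still meets for the preorder: the product of the two implications lies below
    each of them, hence below [x \imp (y]&[z)]. *)
Lemma filter_imp_meet x y z :
  F (x \imp (y `&` z)) <-> F (x \imp y) /\ F (x \imp z).
Proof.
split=> [Fx|[Fxy Fxz]].
  by split; apply: filter_imp_trans Fx (filter_imp_le _);
    rewrite ?leIl ?leIr.
apply: (reslat_filterW FF (reslat_filterM FF Fxy Fxz)).
rewrite -odot_imp lexI; apply/andP; split.
  exact: le_trans (odot_le2r _ (odot_lel _ _)) (odot_impl _ _).
exact: le_trans (odot_le2r _ (odot_ler _ _)) (odot_impl _ _).
Qed.

Lemma filter_imp_join x y z :
  F ((x `|` y) \imp z) <-> F (x \imp z) /\ F (y \imp z).
Proof.
split=> [Fx|[Fxz Fyz]].
  by split; apply: filter_imp_trans (filter_imp_le _) Fx;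
    rewrite ?leUl ?leUr.
apply: (reslat_filterW FF (reslat_filterM FF Fxz Fyz)).
(* Residuating on the other factor leaves the join alone on the left, where it splits into two
   inequalities. *)
rewrite -odot_imp odotC odot_imp leUx -!odot_imp ![_ \odot (_ \odot _)]odotC.
apply/andP; split.
  exact: le_trans (odot_le2r _ (odot_lel _ _)) (odot_impl _ _).
exact: le_trans (odot_le2r _ (odot_ler _ _)) (odot_impl _ _).
Qed.

Lemma thetaE x y : theta F x y <-> F (x \imp y) /\ F (y \imp x).
Proof. exact: reslat_filterE. Qed.

Lemma theta_refl x : theta F x x.
Proof. by apply/thetaE; split; exact: filter_imp_le. Qed.

Lemma theta_sym x y : theta F x y -> theta F y x.
Proof. by rewrite !thetaE => -[]. Qed.

Lemma theta_trans y x z : theta F x y -> theta F y z -> theta F x z.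
Proof.
move=> /thetaE[xy yx] /thetaE[yz zy].
by apply/thetaE; split; apply: (@filter_imp_trans y).
Qed.

Lemma theta_classP x y : theta_class F x = theta_class F y <-> theta F x y.
Proof.
split=> [E|xy].
  by have : theta_class F y y := theta_refl y; rewrite -E.
rewrite eqEsubset; split=> z /=; first exact: theta_trans (theta_sym xy).
exact: theta_trans xy.
Qed.

End filter_preorder.

(** * The quotient residuated lattice [L/F] *)

Section quotient.
Context {d : Order.disp_t} {L : resLatticeType d} {F : set L}.
Variable FF : reslat_filter F.

Let theta_rel : rel L := fun x y => `[< theta F x y >].

Let theta_rel_refl : reflexive theta_rel.
Proof. by move=> x; apply/asboolP; exact: theta_refl. Qed.

Let theta_rel_sym : symmetric theta_rel.
Proof. by move=> x y; apply/asboolP/asboolP; exact: theta_sym. Qed.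

Let theta_rel_trans : transitive theta_rel.
Proof.
move=> y x z /asboolP xy /asboolP yz; apply/asboolP.
exact: theta_trans xy yz.
Qed.

Definition theta_equiv : equiv_rel L :=
  EquivRel theta_rel theta_rel_refl theta_rel_sym theta_rel_trans.

Definition filter_quot : Type := {eq_quot theta_equiv}.
HB.instance Definition _ := Choice.on filter_quot.

Definition quot_pi (x : L) : filter_quot := \pi_{eq_quot theta_equiv} x.

Lemma quot_piP x y : quot_pi x = quot_pi y <-> theta F x y.
Proof.
split=> [/(@eqmodP _ theta_equiv)|xy]; first exact: asboolW.
by apply/(@eqmodP _ theta_equiv); exact: asboolT.
Qed.

Definition quot_repr (a : filter_quot) : L := repr (a : {eq_quot theta_equiv}).

Lemma quot_reprK a : quot_pi (quot_repr a) = a.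
Proof. exact: reprK. Qed.

Lemma quot_repr_pi x : theta F (quot_repr (quot_pi x)) x.
Proof. by apply/quot_piP; rewrite quot_reprK. Qed.

Lemma quot_ind (P : filter_quot -> Prop) :
  (forall x, P (quot_pi x)) -> forall a, P a.
Proof. by move=> Ppi a; rewrite -[a]quot_reprK. Qed.

Let le (a b : filter_quot) : bool := `[< F (quot_repr a \imp quot_repr b) >].

(** Congruent elements are equivalent for the preorder, so transitivity on both sides absorbs the
    choice of representatives. *)
Let le_pi x y : le (quot_pi x) (quot_pi y) <-> F (x \imp y).
Proof.
have /(thetaE FF)[xx' x'x] := quot_repr_pi x.
have /(thetaE FF)[yy' y'y] := quot_repr_pi y.
split=> [/asboolP|] xy; last apply/asboolP.
  exact (filter_imp_trans FF x'x (filter_imp_trans FF xy yy')).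
exact (filter_imp_trans FF xx' (filter_imp_trans FF xy y'y)).
Qed.

Let le_refl : reflexive le.
Proof. by elim/quot_ind => x; apply/le_pi; exact: filter_imp_le. Qed.

Let le_anti : antisymmetric le.
Proof.
elim/quot_ind => x; elim/quot_ind => y /andP[/le_pi xy /le_pi yx].
by apply/quot_piP/(thetaE FF).
Qed.

Let le_trans : transitive le.
Proof.
elim/quot_ind => y; elim/quot_ind => x; elim/quot_ind => z /le_pi xy /le_pi yz.
by apply/le_pi; apply: filter_imp_trans xy yz.
Qed.

HB.instance Definition _ := @Order.Le_isPOrder.Build d filter_quot
  le le_refl le_anti le_trans.

Lemma quot_pi_le x y : (quot_pi x <= quot_pi y) <-> F (x \imp y).
Proof. exact: le_pi. Qed.

(** Computed on chosen representatives. Compatibility with [quot_pi] is shown directly for [odot];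
    for meet, join and [imp] it follows from their universal properties in [quot_pi_morphism]. *)
Let lift (op : L -> L -> L) (a b : filter_quot) : filter_quot :=
  quot_pi (op (quot_repr a) (quot_repr b)).

Let quot_le a b : (a <= b) <-> F (quot_repr a \imp quot_repr b).
Proof. by rewrite -quot_pi_le !quot_reprK. Qed.

Let quot_le_pil x b : (quot_pi x <= b) <-> F (x \imp quot_repr b).
Proof. by rewrite -quot_pi_le quot_reprK. Qed.

Let quot_le_pir a x : (a <= quot_pi x) <-> F (quot_repr a \imp x).
Proof. by rewrite -quot_pi_le quot_reprK. Qed.

Let meetP a b c : (a <= lift Order.meet b c) = (a <= b) && (a <= c).
Proof.
apply/idP/andP; rewrite quot_le_pir !quot_le; by rewrite (filter_imp_meet FF).
Qed.

Let joinP a b c : (lift Order.join a b <= c) = (a <= c) && (b <= c).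
Proof.
apply/idP/andP; rewrite quot_le_pil !quot_le; by rewrite (filter_imp_join FF).
Qed.

HB.instance Definition _ :=
  @Order.POrder_MeetJoin_isLattice.Build d filter_quot _ _ meetP joinP.

Let le0x (a : filter_quot) : quot_pi \bot <= a.
Proof. by apply/quot_le_pil; exact: filter_imp_le (le0x _). Qed.

Let lex1 (a : filter_quot) : a <= quot_pi \top.
Proof. by apply/quot_le_pir; exact: filter_imp_le (lex1 _). Qed.

HB.instance Definition _ := @Order.hasBottom.Build d filter_quot _ le0x.
HB.instance Definition _ := @Order.hasTop.Build d filter_quot _ lex1.

Let odot_imp a b c : (lift odot a b <= c) = (a <= lift imp b c).
Proof. by apply/idP/idP; rewrite quot_le_pil quot_le_pir imp_odot. Qed.

Let odotC : commutative (lift odot).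
Proof. by move=> a b; rewrite /lift odotC. Qed.

Let pi_odot x y : lift odot (quot_pi x) (quot_pi y) = quot_pi (x \odot y).
Proof.
(* The product is monotone for the preorder because [v <= w \imp (v \odot w)]; the two factors are
   then replaced one at a time. *)
have mono u v w : F (u \imp v) -> F ((u \odot w) \imp (v \odot w)).
  move=> uv; rewrite imp_odot; apply: (filter_imp_trans FF uv).
  by apply: (filter_imp_le FF); rewrite -Defs.odot_imp.
have /(thetaE FF)[xx' x'x] := quot_repr_pi x.
have /(thetaE FF)[yy' y'y] := quot_repr_pi y.
apply/quot_piP/(thetaE FF); split.
  apply: (filter_imp_trans FF (mono _ _ _ xx')).
  by rewrite ![x \odot _]Defs.odotC; exact: mono.
apply: (filter_imp_trans FF (mono _ _ _ x'x)).
by rewrite ![quot_repr (quot_pi x) \odot _]Defs.odotC; exact: mono.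
Qed.

Let odotA : associative (lift odot).
Proof.
elim/quot_ind => x; elim/quot_ind => y; elim/quot_ind => z.
by rewrite !pi_odot odotA.
Qed.

Let odot1x : left_id \top (lift odot).
Proof. by elim/quot_ind => x; rewrite [LHS]pi_odot odot1x. Qed.

HB.instance Definition _ := @TBLattice_isResiduated.Build d filter_quot
  _ _ odotA odotC odot1x odot_imp.

Lemma quot_pi_morphism : reslat_morphism quot_pi.
Proof.
(* Since [quot_pi] is onto, an element of the quotient is determined by the classes below it, and
   equally by the classes above it. The first form suits meet and [imp], the second suits join. *)
have le_yoneda (a b : filter_quot) :
      (forall z, quot_pi z <= a <-> quot_pi z <= b) -> a = b.
  move=> E; apply/Order.POrderTheory.le_anti/andP; split.
    by rewrite -[a]quot_reprK -E quot_reprK.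
  by rewrite -[b]quot_reprK E quot_reprK.
have ge_yoneda (a b : filter_quot) :
      (forall z, a <= quot_pi z <-> b <= quot_pi z) -> a = b.
  move=> E; apply/Order.POrderTheory.le_anti/andP; split.
    by rewrite -[b]quot_reprK E quot_reprK.
  by rewrite -[a]quot_reprK -E quot_reprK.
split=> // x y.
- apply: le_yoneda => z.
  rewrite lexI quot_pi_le (filter_imp_meet FF) -!quot_pi_le.
  by split=> /andP.
- apply: ge_yoneda => z.
  rewrite leUx quot_pi_le (filter_imp_join FF) -!quot_pi_le.
  by split=> /andP.
- by rewrite -pi_odot.
- apply: le_yoneda => z.
  rewrite -Defs.odot_imp.
  rewrite -[quot_pi z \odot _]/(lift odot _ _) pi_odot !quot_pi_le.
  by rewrite imp_odot.
Qed.

End quotient.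

(** * Compactness and continuity *)

Lemma compact_discrete_range (X : topologicalType) (Q : choiceType)
    (f : X -> discrete_topology Q) :
  compact [set: X] -> continuous f -> finite_set (range f).
Proof.
move=> /compact_near_coveringP cX cf.
(* Near-covering compactness is used along the filter of large finite subsets of [Q]. On the open
   fiber of [f] through [x], every finite set containing [f x] contains the values of [f]; so a
   single finite set contains all values. *)
pose up (B : set Q) := [set C : set Q | finite_set C /\ B `<=` C].
have FF : Filter (filter_from [set B : set Q | finite_set B] up).
  apply: filter_from_filter; first by exists set0; exact: finite_set0.
  move=> B C fB fC; exists (B `|` C); first by rewrite /= finite_setU.
  by move=> D [fD BCD]; split; split=> // x ?; apply: BCD; [left|right].
have [x _|B fB BE] := cX _ _ (fun B x => B (f x)) FF.
  exists ([set y | f y = f x], up [set f x]) => /=.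
    split; last by exists [set f x] => //; exact: finite_set1.
    by apply: (cf x [set f x]); exact: (@discrete_set1 (discrete_topology Q)).
  by move=> [y C] /= [-> [_ xC]]; exact: xC.
have /= subB := BE B (conj fB (@subset_refl _ B)).
by apply: (sub_finite_set _ fB) => _ [x _ <-]; exact: subB.
Qed.

(** By directedness the sets [K]&[C i] form a base of a proper filter; a cluster point of it in [K]
    lies in every closed [C i]. *)
Lemma compact_directed_bigcap (X : topologicalType) (K : set X) (I : Type)
    (C : I -> set X) :
  compact K -> K !=set0 -> (forall i, closed (C i)) ->
  (forall i j, exists k, C k `<=` C i `&` C j) ->
  (forall i, K `&` C i !=set0) -> K `&` \bigcap_i C i !=set0.
Proof.
move=> cK [x0 Kx0] clC dirC KC.
(* Over an empty index type the intersection is the whole space, and the given point of [K] is the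
   witness. *)
have [[i0]|noI] := pselect (inhabited I); last first.
  by exists x0; split=> // i _; case: noI.
have FF : Filter (filter_from [set: I] (fun i => K `&` C i)).
  apply: filter_from_filter; first by exists i0.
  move=> i j _ _; have [k Ck] := dirC i j; exists k => //.
  by move=> x [Kx /Ck[]].
have PF := filter_from_proper FF (fun i _ => KC i).
have [|x [Kx clx]] := cK _ PF; first by exists i0 => // x [].
exists x; split=> // i _; apply: clC => U Ux.
have [|y [[_ Cy] Uy]] := clx (K `&` C i) U _ Ux; first by exists i.
by exists y.
Qed.

Lemma continuous_op_comp (X : topologicalType) (T : Type) (tau : Topological T)
    (op : T -> T -> T) (f g : X -> Defs.space tau) :
  continuous_op tau op -> continuous f -> continuous g ->
  continuous (fun x => op (f x) (g x) : Defs.space tau).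
Proof.
move=> cop cf cg x.
exact: (@continuous2_cvg _ (Defs.space tau) (Defs.space tau) (Defs.space tau)
  _ _ f g op (f x) (g x) (cop (f x, g x)) (cf x) (cg x)).
Qed.

(** The class of [x] is the preimage of the open set [F] under the continuous map [biimp], so
    [quot_pi] is constant near [x]. *)
Lemma quot_pi_continuous d (L : topResLatticeType d) (F : set L)
    (FF : reslat_filter F) :
  open (F : set (topspace L)) ->
  continuous (quot_pi FF : topspace L -> discrete_topology (filter_quot FF)).
Proof.
move=> oF x; apply/(@discrete_cvg (discrete_topology (filter_quot FF))).
pose biimp (y : topspace L) : topspace L :=
  ((x : L) \imp y) \odot ((y : L) \imp x).
have cimp (f g : topspace L -> topspace L) : continuous f -> continuous g ->
    continuous (fun y => (f y : L) \imp g y : topspace L).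
  exact: (continuous_op_comp (@imp_continuous _ L)).
have cbiimp : continuous biimp.
  apply: (continuous_op_comp (@odot_continuous _ L)).
    by apply: (cimp (fun=> x) id) => y; [exact: cvg_cst|exact: cvg_id].
  by apply: (cimp id (fun=> x)) => y; [exact: cvg_id|exact: cvg_cst].
have : nbhs (biimp x) F.
  by apply: open_nbhs_nbhs; split=> //; exact: (theta_refl FF).
move=> /(cbiimp x); apply: (@filterS _ (nbhs x)) => y xy.
exact/esym/quot_piP.
Qed.

(** * The inverse system of quotients and its limit *)

Section quotient_system.
Context {d : Order.disp_t} {L : topResLatticeType d} {S : set (set L)}.
Hypothesis S_filter : forall F, S F -> reslat_filter F.
Hypothesis S_directed : forall F G, S F -> S G ->
  exists2 H, S H & H `<=` F `&` G.

Definition filter_index : Type := set_type S.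
HB.instance Definition _ := Choice.on filter_index.

(** Reverse inclusion: a larger index is a smaller filter, hence a finer quotient, which maps onto
    the coarser ones. *)
Let le (F G : filter_index) : bool := `[< set_val G `<=` set_val F >].

Let le_refl : reflexive le.
Proof. by move=> F; apply/asboolP. Qed.

Let le_anti : antisymmetric le.
Proof.
move=> F G /andP[/asboolP GF /asboolP FG].
by apply: val_inj; apply/seteqP; split.
Qed.

Let le_trans : transitive le.
Proof.
move=> G F H /asboolP GF /asboolP HG; apply/asboolP.
exact: subset_trans HG GF.
Qed.

HB.instance Definition _ := @Order.Le_isPOrder.Build d filter_index
  le le_refl le_anti le_trans.

Lemma filter_index_leP (F G : filter_index) :
  reflect (set_val G `<=` set_val F) (F <= G).
Proof. exact: asboolP. Qed.

Lemma filter_index_directed (F G : filter_index) : exists H, F <= H /\ G <= H.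
Proof.
have [H SH HFG] := S_directed (set_valP F) (set_valP G).
exists (SigSub (mem_set SH) : filter_index).
by split; apply/filter_index_leP => x /HFG[].
Qed.

Definition quot_obj (F : filter_index) : resLatticeType d :=
  filter_quot (S_filter (set_valP F)).

Definition quot_proj (F : filter_index) : L -> quot_obj F :=
  quot_pi (S_filter (set_valP F)).

Lemma quot_obj_ind F (P : quot_obj F -> Prop) :
  (forall x, P (quot_proj F x)) -> forall a, P a.
Proof. exact: quot_ind. Qed.

Definition quot_bond (F G : filter_index) (GF : G <= F) (a : quot_obj F) :
  quot_obj G := quot_proj G (quot_repr a).

(** The chosen representative is congruent to [x] modulo [F], hence modulo the larger filter [G].
    This makes [quot_bond] independent of the choice. *)
Lemma quot_bond_proj F G (GF : G <= F) x :
  quot_bond GF (quot_proj F x) = quot_proj G x.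
Proof.
apply/quot_piP; apply: (filter_index_leP _ _ GF); exact: quot_repr_pi.
Qed.

(** The bond composed with the surjective morphism [quot_proj F] is the morphism [quot_proj G], so
    it inherits every equation. *)
Lemma quot_bond_morphism F G (GF : G <= F) : reslat_morphism (quot_bond GF).
Proof.
have mF : reslat_morphism (quot_proj F) := quot_pi_morphism _.
have mG : reslat_morphism (quot_proj G) := quot_pi_morphism _.
split; do ?[elim/quot_obj_ind=> x; elim/quot_obj_ind=> y].
- by rewrite -(reslat_morphI mF) !quot_bond_proj (reslat_morphI mG).
- by rewrite -(reslat_morphU mF) !quot_bond_proj (reslat_morphU mG).
- by rewrite -(reslat_morphM mF) !quot_bond_proj (reslat_morphM mG).
- by rewrite -(reslat_morphR mF) !quot_bond_proj (reslat_morphR mG).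
- by rewrite -(reslat_morph0 mF) quot_bond_proj (reslat_morph0 mG).
- by rewrite -(reslat_morph1 mF) quot_bond_proj (reslat_morph1 mG).
Qed.

Lemma quot_bond_id F : quot_bond (lexx F) =1 id.
Proof. by elim/quot_obj_ind => x; rewrite [LHS]quot_bond_proj. Qed.

Lemma quot_bond_comp F G H (GF : G <= F) (HG : H <= G) :
  quot_bond (Order.PreorderTheory.le_trans HG GF) =1
    quot_bond HG \o quot_bond GF.
Proof. by elim/quot_obj_ind => x; rewrite /= !quot_bond_proj. Qed.

Definition quot_system : inverse_system :=
  InverseSystem filter_index_directed
    quot_bond_morphism quot_bond_id quot_bond_comp.

Definition quot_thread (x : L) : inverse_limit quot_system :=
  mk_thread (S := quot_system) (a := fun F => quot_proj F x)
    (fun F G GF => quot_bond_proj GF x).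

Lemma quot_thread_coord F x :
  lim_coord (S := quot_system) F (quot_thread x) = quot_proj F x.
Proof. by []. Qed.

Lemma quot_thread_morphism : reslat_morphism quot_thread.
Proof.
have mF F : reslat_morphism (quot_proj F) := quot_pi_morphism _.
by split=> [x y|x y|x y|x y||]; apply: lim_coord_inj => F;
  [exact: reslat_morphI|exact: reslat_morphU|exact: reslat_morphM
  |exact: reslat_morphR|exact: reslat_morph0|exact: reslat_morph1].
Qed.

Hypothesis S_open : forall F, S F -> open (F : set (topspace L)).
Hypothesis S_separates : forall x y : L, x <> y ->
  exists2 F, S F & theta_class F x <> theta_class F y.
Hypothesis L_compact : compact [set: topspace L].

Lemma quot_proj_continuous F :
  continuous (quot_proj F : topspace L -> discrete_topology (quot_obj F)).
Proof. by apply: quot_pi_continuous; exact: S_open (set_valP F). Qed.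

Lemma quot_proj_fiber_closed F a :
  closed ([set x | quot_proj F x = a] : set (topspace L)).
Proof.
apply: (@closed_comp _ _
  (quot_proj F : topspace L -> discrete_topology (quot_obj F)) [set a]).
  by move=> x _; exact: quot_proj_continuous.
exact: (@discrete_closed (discrete_topology (quot_obj F))).
Qed.

Lemma quot_obj_finite F : finite_set [set: quot_obj F].
Proof.
have := compact_discrete_range L_compact (@quot_proj_continuous F).
by apply: sub_finite_set; elim/quot_obj_ind => x _; exists x.
Qed.

Lemma quot_thread_inj : injective quot_thread.
Proof.
move=> x y xy; apply: contrapT => /S_separates[F SF].
apply; apply/theta_classP; first exact: S_filter.
pose i : filter_index := SigSub (mem_set SF).
have /quot_piP : quot_proj i x = quot_proj i y.
  by rewrite -!quot_thread_coord xy.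
by [].
Qed.

(** Stated relative to [K] to serve twice: with the whole space for surjectivity, and with the
    complement of an open set for continuity of the inverse. *)
Lemma quot_thread_fiber (a : inverse_limit quot_system) (K : set (topspace L)) :
  compact K -> K !=set0 ->
  (forall F, exists2 x,
    K x & quot_proj F x = lim_coord (S := quot_system) F a) ->
  exists2 x, K x & quot_thread x = a.
Proof.
move=> cK K0 Ka.
pose C (F : filter_index) : set (topspace L) :=
  [set x | quot_proj F x = lim_coord (S := quot_system) F a].
have [|F|F|x [Kx Cx]] := @compact_directed_bigcap _ K filter_index C cK K0.
- by move=> F; exact: quot_proj_fiber_closed.
(* The bonds out of [H] send [a] at [H] to [a] at [F] and at [G], so the fiber over [H] lies in both
   other fibers. *)
- move=> G; have [H [FH GH]] := filter_index_directed F G; exists H => x Hx.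
  by split; rewrite /C /= -(quot_bond_proj FH, quot_bond_proj GH) Hx;
    exact: (lim_coord_bond (S := quot_system)).
- by have [x Kx xa] := Ka F; exists x.
by exists x => //; apply: lim_coord_inj => F; exact: Cx.
Qed.

Lemma quot_thread_surj a : exists x, quot_thread x = a.
Proof.
have [|F|x _ xa] := @quot_thread_fiber a [set: topspace L] L_compact.
- by exists (\top : L).
- exists (quot_repr (lim_coord (S := quot_system) F a)) => //.
  exact: quot_reprK.
by exists x.
Qed.

Lemma quot_thread_isomorphic :
  top_reslat_isomorphic L (inverse_limit quot_system).
Proof.
pose g a := projT1 (cid (quot_thread_surj a)).
have gK : cancel g quot_thread by move=> a; rewrite /g; case: cid.
exists quot_thread, g; split=> //.
- exact: quot_thread_morphism.
- by move=> x; apply: quot_thread_inj; rewrite gK.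
- by apply: lim_continuous => F; exact: quot_proj_continuous.
move=> a U /=; rewrite (@nbhsE (topspace L)) => -[V [oV Vga] VU].
change (nbhs (a : topspace (inverse_limit quot_system)) (g @^-1` U)).
(* [quot_thread_fiber] needs a nonempty compact set, so the case where [V] is the whole space is
   settled apart. *)
have [V0|/set0P V0] := eqVneq (~` V) set0.
  apply: filterS filterT => b _; apply: VU; apply: contrapT => Vgb.
  by have : (~` V) (g b) by []; rewrite V0.
(* Otherwise the compact complement of [V] meets every fiber over [a], so it contains a point with
   thread [a]; by injectivity that point is [g a], which lies in [V]. *)
have [F FV] : exists F, forall x,
    quot_proj F x = lim_coord (S := quot_system) F a -> V x.
  apply: contrapT => noF.
  have Va F : exists2 x : L, (~` (V : set L)) x &
      quot_proj F x = lim_coord (S := quot_system) F a.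
    apply: contrapT => nox; apply: noF; exists F => x xa; apply: contrapT => Vx.
    by apply: nox; exists x.
  have [|x Vx] := @quot_thread_fiber a (~` V) _ V0 Va.
    by apply: (subclosed_compact _ L_compact) => //; exact: open_closedC.
  by move=> xa; apply: Vx; rewrite -(quot_thread_inj (etrans (gK a) (esym xa))).
(* Threads agreeing with [a] at the single index [F] form a neighbourhood of [a], and [g] sends each
   of them into [V]. *)
have : nbhs (a : topspace (inverse_limit quot_system))
    [set b | lim_coord (S := quot_system) F b =
             lim_coord (S := quot_system) F a].
  apply: (@lim_coord_continuous quot_system F a
    [set lim_coord (S := quot_system) F a]).
  exact: (@discrete_set1 (discrete_topology (quot_obj F))).
apply: filterS => b ba; apply/VU/FV.
by rewrite -quot_thread_coord gK.
Qed.

End quotient_system.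

(** * Kernels of the projections of a profinite lattice, and the equivalence *)

Lemma profinite_clopen_filters d (L : topResLatticeType d) :
  profinite L ->
  exists S : set (set L),
     [/\ forall F, S F -> reslat_filter F /\ clopen (F : set (topspace L)),
         forall F G, S F -> S G -> exists2 H, S H & H `<=` F `&` G
       & forall x y : L, x <> y ->
           exists2 F, S F & theta_class F x <> theta_class F y].
Proof.
move=> [T [_ [f [g [fM fK gK cf _]]]]].
pose coord i (x : L) := lim_coord i (f x : lim_type T).
have coordM i : reslat_morphism (coord i).
  have coordE (a b : inverse_limit T) : a = b ->
    lim_coord i (a : lim_type T) = lim_coord i (b : lim_type T) by move=> ->.
  split=> [x y|x y|x y|x y||].
  - exact: coordE (reslat_morphI fM x y).
  - exact: coordE (reslat_morphU fM x y).
  - exact: coordE (reslat_morphM fM x y).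
  - exact: coordE (reslat_morphR fM x y).
  - exact: coordE (reslat_morph0 fM).
  - exact: coordE (reslat_morph1 fM).
pose ker i : set L := [set x | coord i x = \top].
have kerF i : reslat_filter (ker i).
  split.
  - by exists \top; exact: reslat_morph1.
  - by move=> x y; rewrite /ker /= (reslat_morphM (coordM i)) odot_eq1.
  (* Order is read off as [x \imp y = \top], an equation that the morphism [coord i] preserves. *)
  - move=> x y /= xi /imp_le xy; apply/eqP; rewrite -le1x -xi; apply/imp_le.
    by rewrite -(reslat_morphR (coordM i)) xy; exact: reslat_morph1.
exists (range ker); split.
- move=> _ [i _ <-]; split=> //.
  pose D := discrete_topology (obj i).
  apply: (@preimage_clopen (topspace L) D (coord i) [set \top]).
    by split; [exact: discrete_open|exact: discrete_closed].
  move=> x.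
  apply: (@continuous_comp (topspace L) (lim_type T) D f (lim_coord i) x).
    exact: cf.
  exact: lim_coord_continuous.
(* Bonds preserve the top, so the kernel at an index [k] above [i] and [j] is contained in both
   kernels. *)
- move=> _ _ [i _ <-] [j _ <-]; have [k [ik jk]] := idx_directed i j.
  exists (ker k); first by exists k.
  move=> x /= kx; split; rewrite /ker /= /coord.
    rewrite -(lim_coord_bond ik) [lim_coord k _]kx.
    exact: reslat_morph1 (bond_morphism ik).
  rewrite -(lim_coord_bond jk) [lim_coord k _]kx.
  exact: reslat_morph1 (bond_morphism jk).
move=> x y xy; apply: contrapT => nosep; apply: xy; apply: (can_inj fK).
(* If no kernel separates [x] and [y], their biimplication has top image in each coordinate, and
   [biimp_eq1] makes the coordinates equal. *)
apply: lim_coord_inj => i.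
have /(theta_classP (kerF i)) : theta_class (ker i) x = theta_class (ker i) y.
  by apply: contrapT => xyi; apply: nosep; exists (ker i) => //; exists i.
rewrite /theta /ker /= (reslat_morphM (coordM i)) !(reslat_morphR (coordM i)).
by move=> /biimp_eq1.
Qed.

Theorem theorem3p10 (d : Order.disp_t) (L : topResLatticeType d) :
  compact [set: topspace L] ->
  (profinite L <->
   exists S : set (set L),
     [/\ forall F, S F -> reslat_filter F /\ clopen (F : set (topspace L)),
         forall F G, S F -> S G -> exists2 H, S H & H `<=` F `&` G
       & forall x y : L, x <> y ->
           exists2 F, S F & theta_class F x <> theta_class F y]).
Proof.
move=> cL; split=> [|[S [Sclopen Sdir Ssep]]].
  exact: profinite_clopen_filters.
have SF F : S F -> reslat_filter F by move=> /Sclopen[].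
have So F : S F -> open (F : set (topspace L)) by move=> /Sclopen[_ []].
exists (quot_system SF Sdir); split; first exact: quot_obj_finite.
exact: quot_thread_isomorphic.
Qed.
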